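(* Let $m$ be a positive integer and let $2\leq p\leq\infty$. Then the exponent $\frac{2p}{mp+2}$ (read as $\frac{2}{m}$ if $p=\infty$) is optimal for the absolute $(r;1)$-summability of continuous $m$-linear operators from $\ell_1\times\cdots\times\ell_1$ to $\ell_p$, in the sense that it cannot be replaced by a smaller one: for every real $r$ with $0<r<\frac{2p}{mp+2}$ there exists a continuous $m$-linear operator $T:\ell_1\times\cdots\times\ell_1\to\ell_p$ which is not absolutely $(r;1)$-summing.
   Context: All Banach spaces are over $\mathbb{K}=\mathbb{R}$ or $\mathbb{C}$. For a Banach space $E$ with dual $E^*$ and closed dual unit ball $B_{E^*}$, and $1\le s<\infty$, $\ell_s^w(E)$ is the space of sequences $(x_j)_{j=1}^\infty$ in $E$ with $\|(x_j)_{j=1}^\infty\|_{w,s}:=\sup_{\varphi\in B_{E^*}}\left(\sum_{j=1}^\infty|\varphi(x_j)|^s\right)^{1/s}<\infty$. For $r\in(0,\infty)$, a continuous $m$-linear operator $T:E_1\times\cdots\times E_m\to F$ between Banach spaces is absolutely $(r;s)$-summing if there is a constant $C>0$ such that $\left(\sum_{j=1}^\infty\|T(x_j^{(1)},\ldots,x_j^{(m)})\|_F^r\right)^{1/r}\le C\prod_{k=1}^m\|(x_j^{(k)})_{j=1}^\infty\|_{w,s}$ for all $(x_j^{(k)})_{j=1}^\infty\in\ell_s^w(E_k)$, $k=1,\ldots,m$. *)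

(* Defs.v *)
From HB Require Import structures.
From mathcomp Require Import all_boot all_order all_algebra.
From mathcomp Require Import complex.
From mathcomp Require Import all_classical all_reals all_analysis.
From mathcomp Require Import ess_sup_inf.

Set Implicit Arguments.
Unset Strict Implicit.
Unset Printing Implicit Defensive.

Import Order.TTheory GRing.Theory Num.Theory.
Import numFieldNormedType.Exports.

Local Open Scope classical_set_scope.
Local Open Scope ring_scope.

Variant scalar_kind := RealScalars | ComplexScalars.

Definition scalars (R : realType) (k : scalar_kind) : numFieldType :=
  match k with RealScalars => R | ComplexScalars => R[i] end.

(* Norms of [normedModType K] take values in [K] itself (as nonnegative
   elements).  [realpart] brings them back to [R]; [of_real] is the inclusion
   of [R] in [K]. *)
Definition realpart (R : realType) (k : scalar_kind) : scalars R k -> R :=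
  match k with
  | RealScalars => fun x => x
  | ComplexScalars => fun z => complex.Re z
  end.

Definition of_real (R : realType) (k : scalar_kind) : R -> scalars R k :=
  match k with
  | RealScalars => fun x => x
  | ComplexScalars => fun x => (x%:C)%C
  end.

Definition rnorm (R : realType) (k : scalar_kind)
  (V : normedModType (scalars R k)) (x : V) : R := realpart `|x|.

Section scalar_lemmas.
Context (R : realType) (k : scalar_kind).
Local Notation K := (scalars R k).

Lemma of_realD (x y : R) : of_real k (x + y) = of_real k x + of_real k y.
Proof. by case: k => //=; exact: rmorphD. Qed.

Lemma of_realM (x y : R) : of_real k (x * y) = of_real k x * of_real k y.
Proof. by case: k => //=; exact: rmorphM. Qed.

Lemma of_real0 : of_real k (0 : R) = 0.
Proof. by case: k. Qed.

Lemma of_realK (x : R) : realpart (of_real k x) = x.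
Proof. by case: k. Qed.

Lemma of_real_le (x y : R) : (of_real k x <= of_real k y) = (x <= y).
Proof. by case: k => //=; exact: lecR. Qed.

Lemma realpartK (x : K) : 0 <= x -> of_real k (realpart x) = x.
Proof.
case: k x => //= -[a b]; rewrite lecE/= => /andP[/eqP -> _].
by [].
Qed.

Lemma of_rnorm (V : normedModType K) (x : V) : of_real k (rnorm x) = `|x|.
Proof. exact: realpartK. Qed.

Lemma rnorm_ge0 (V : normedModType K) (x : V) : 0 <= rnorm x.
Proof. by rewrite -of_real_le of_real0 of_rnorm. Qed.

Lemma rnorm0 (V : normedModType K) : rnorm (0 : V) = 0.
Proof. by rewrite /rnorm normr0 -of_real0 of_realK. Qed.

Lemma rnorm_eq0 (V : normedModType K) (x : V) : rnorm x = 0 -> x = 0.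
Proof.
by move=> x0; apply/eqP; rewrite -normr_eq0 -of_rnorm x0 of_real0.
Qed.

Lemma ler_rnormD (V : normedModType K) (x y : V) :
  rnorm (x + y) <= rnorm x + rnorm y.
Proof. by rewrite -of_real_le of_realD !of_rnorm ler_normD. Qed.

Lemma rnormZ (V : normedModType K) (a : K) (x : V) :
  rnorm (a *: x) = rnorm (a : K^o) * rnorm x.
Proof.
by rewrite -[LHS](of_realK) of_rnorm normrZ -!of_rnorm -of_realM of_realK.
Qed.

End scalar_lemmas.

Section lp.
Context (R : realType) (k : scalar_kind).
Local Notation K := (scalars R k).

(* The Lp-norm for the counting measure: [lp_norm_fin] and [lp_norm_infty]
   below give the usual formulas for finite and infinite exponents. *)
Definition lp_norm (p : \bar R) (x : nat -> K^o) : \bar R :=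
  Lnorm (@counting nat R) p (fun j => (rnorm (x j))%:E).

Lemma lp_norm_fin (r : R) (x : nat -> K^o) : 0 < r ->
  lp_norm r%:E x = ((\sum_(0 <= j <oo) (rnorm (x j) `^ r)%:E) `^ r^-1)%E.
Proof.
move=> r0; rewrite /lp_norm Lnorm_counting//; congr (_ `^ _)%E.
by apply: eq_eseriesr => j _; rewrite abse_EFin ger0_norm ?rnorm_ge0.
Qed.

Lemma ae_counting (P : set nat) :
  (\forall x \ae @counting nat R, P x) -> forall j, P j.
Proof.
move=> [A [_ A0 PA]] j; apply: contrapT => nPj.
have Aj : A j by exact: PA.
have : (@counting nat R [set j] <= @counting nat R A)%E.
  apply: le_measure; rewrite ?inE//.
  by move=> _ ->.
rewrite A0 /counting asboolT//.
by rewrite fset_set1 finmap.cardfs1 lee_fin ler10.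
Qed.

Lemma lp_norm_infty (x : nat -> K^o) :
  lp_norm +oo%E x = ereal_sup (range (fun j => (rnorm (x j))%:E)).
Proof.
rewrite /lp_norm unlock.
rewrite ifT; last first.
  by rewrite [ltRHS](_ : _ = +oo%E) ?ltry//= /counting asboolF//; exact: infinite_nat.
have E : abse \o (fun j => (rnorm (x j))%:E) = (fun j => (rnorm (x j))%:E).
  by apply/funext => j /=; rewrite ger0_norm ?rnorm_ge0.
rewrite E; apply/eqP; rewrite eq_le; apply/andP; split.
  apply/ess_supP/nearW => j; exact: ereal_sup_ubound.
apply: ub_ereal_sup => _ [j _ <-].
exact: (ae_counting (ess_sup_ge _ _)).
Qed.


Variables (p : \bar R) (p1 : (1 <= p)%E).

Lemma le_lp_norm (f g : nat -> R) : (forall j, 0 <= f j <= g j) ->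
  (Lnorm (@counting nat R) p (EFin \o f) <=
   Lnorm (@counting nat R) p (EFin \o g))%E.
Proof.
move=> fg.
have absf j : (`|(f j)%:E| <= `|(g j)%:E|)%E.
  have /andP[f0 h] := fg j.
  by rewrite !abse_EFin lee_fin !ger0_norm// (le_trans f0).
case: p p1 => [r r1| _|//].
  have r0 : 0 < r by move: r1; rewrite lee_fin; exact: lt_le_trans.
  rewrite !Lnorm_counting//; apply: gt0_ler_poweR.
  - by rewrite invr_ge0 ltW.
  - by rewrite in_itv/= leey andbT nneseries_ge0// => *; exact: poweR_ge0.
  - by rewrite in_itv/= leey andbT nneseries_ge0// => *; exact: poweR_ge0.
  apply: lee_nneseries => [*|j _]; first exact: poweR_ge0.
  apply: gt0_ler_poweR => //; first exact: ltW.
  + by rewrite in_itv/= leey andbT.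
  + by rewrite in_itv/= leey andbT.
  exact: absf.
rewrite unlock; case: ifPn => // _; apply: le_ess_sup; exact: nearW.
Qed.

Lemma lp_norm_ge0 (x : nat -> K^o) : (0 <= lp_norm p x)%E.
Proof. exact: Lnorm_ge0. Qed.

Lemma lp_norm0 : lp_norm p (fun=> 0) = 0%E.
Proof.
rewrite /lp_norm; under eq_Lnorm do rewrite rnorm0.
by apply: Lnorm0; rewrite gt_eqF// (lt_le_trans _ p1).
Qed.

Lemma ler_lp_normD (x y : nat -> K^o) :
  (lp_norm p (x \+ y)%R <= lp_norm p x + lp_norm p y)%E.
Proof.
apply: (@le_trans _ _ (Lnorm (@counting nat R) p
  (EFin \o ((fun j => rnorm (x j)) \+ (fun j => rnorm (y j)))))).
  by apply: le_lp_norm => j; rewrite rnorm_ge0 ler_rnormD.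
exact: eminkowski.
Qed.

Lemma lp_normZ (a : K) (x : nat -> K^o) :
  lp_norm p (fun j => a *: x j) = ((rnorm (a : K^o))%:E * lp_norm p x)%E.
Proof.
have a0 := rnorm_ge0 (a : K^o).
case: p p1 => [r r1| _|//].
  have r0 : 0 < r by move: r1; rewrite lee_fin; exact: lt_le_trans.
  rewrite !lp_norm_fin//.
  under eq_eseriesr do rewrite rnormZ powRM ?rnorm_ge0// EFinM.
  rewrite nneseriesZl; last by move=> *; rewrite lee_fin powR_ge0.
  rewrite poweRM ?lee_fin ?powR_ge0//; last first.
    by apply: nneseries_ge0 => *; rewrite lee_fin powR_ge0.
  by rewrite poweR_EFin -powRrM mulfV ?gt_eqF// powRr1.
rewrite /lp_norm unlock; case: ifPn => mu0; last by rewrite mule0.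
rewrite -ess_supZl//; apply/eq_ess_sup/nearW => j /=.
by rewrite rnormZ normrM (ger0_norm a0).
Qed.

Lemma lp_norm_coord (x : nat -> K^o) j : ((rnorm (x j))%:E <= lp_norm p x)%E.
Proof.
case: p p1 => [r r1| _|//]; last first.
  by rewrite lp_norm_infty; apply: ereal_sup_ubound; exists j.
have r0 : 0 < r by move: r1; rewrite lee_fin; exact: lt_le_trans.
rewrite lp_norm_fin//.
have -> : (rnorm (x j))%:E = ((rnorm (x j) `^ r)%:E `^ r^-1)%E.
  by rewrite poweR_EFin -powRrM mulfV ?gt_eqF// powRr1 ?rnorm_ge0.
apply: gt0_ler_poweR.
- by rewrite invr_ge0 ltW.
- by rewrite in_itv/= leey andbT lee_fin powR_ge0.
- rewrite in_itv/= leey andbT.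
  by apply: nneseries_ge0 => *; rewrite lee_fin powR_ge0.
rewrite (@nneseriesD1 _ _ j)//; last by move=> *; rewrite lee_fin powR_ge0.
by rewrite leeDl// nneseries_ge0// => *; rewrite lee_fin powR_ge0.
Qed.

Definition lp_mem : {pred (nat -> K^o)} :=
  mem [set x : nat -> K^o | (lp_norm p x < +oo)%E].

(* The condition [1 <= p], which makes [lp_norm p] a norm, is a parameter of
   the type so that the normed structure below can be inferred from it. *)
Structure lp_space (p_ge1 : (1 <= p)%E) :=
  Lp { seq_of_lp :> nat -> K^o; _ : seq_of_lp \in lp_mem }.
Local Notation lp := (lp_space p1).

HB.instance Definition _ := [isSub for @seq_of_lp p1].
HB.instance Definition _ := [Choice of lp by <:].

Lemma lp_submod_closed : submod_closed lp_mem.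
Proof.
split; first by rewrite inE/= lp_norm0 ltry.
move=> a x y; rewrite !inE/= => xoo yoo.
apply: le_lt_trans (ler_lp_normD _ _) _.
apply: lte_add_pinfty => //; rewrite lp_normZ.
by rewrite lte_mul_pinfty ?lee_fin ?rnorm_ge0.
Qed.

HB.instance Definition _ :=
  GRing.isSubmodClosed.Build _ _ lp_mem lp_submod_closed.
HB.instance Definition _ := [SubChoice_isSubLmodule of lp by <:].

Lemma lp_fine (x : lp) : (fine (lp_norm p x))%:E = lp_norm p x.
Proof.
rewrite fineK// ge0_fin_numE ?lp_norm_ge0//.
by case: x => x /=; rewrite inE.
Qed.

Definition lp_normK (x : lp) : K := of_real k (fine (lp_norm p x)).

Lemma ler_lp_normKD (x y : lp) : lp_normK (x + y) <= lp_normK x + lp_normK y.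
Proof.
rewrite -of_realD of_real_le -lee_fin EFinD !lp_fine.
exact: ler_lp_normD.
Qed.

Lemma lp_normKZ (a : K) (x : lp) : lp_normK (a *: x) = `|a| * lp_normK x.
Proof.
rewrite -(of_rnorm (a : K^o)) -of_realM; congr of_real.
by apply: EFin_inj; rewrite EFinM !lp_fine; exact: lp_normZ.
Qed.

Lemma lp_normK_eq0 (x : lp) : lp_normK x = 0 -> x = 0.
Proof.
move=> x0; have {}x0 : lp_norm p x = 0%E.
  by rewrite -lp_fine -[fine _](of_realK k) -/(lp_normK x) x0 -of_real0 of_realK.
apply/val_inj/funext => j /=; apply: rnorm_eq0; apply/eqP.
by rewrite eq_le rnorm_ge0 andbT -lee_fin (le_trans (lp_norm_coord _ _))// x0.
Qed.

HB.instance Definition _ :=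
  Lmodule_isNormed.Build K lp ler_lp_normKD lp_normKZ lp_normK_eq0.

Lemma rnorm_lp (x : lp) : rnorm x = fine (lp_norm p x).
Proof. exact: of_realK. Qed.

End lp.


Section summing.
Context (R : realType) (k : scalar_kind).
Local Notation K := (scalars R k).

Definition dual_ball (E : normedModType K) : set (E -> K^o) :=
  [set phi | [/\ linear phi, continuous phi &
                 forall x, rnorm x <= 1 -> rnorm (phi x) <= 1]].

Definition weak_norm (E : normedModType K) (s : R) (x : nat -> E) : \bar R :=
  ereal_sup [set ((\sum_(0 <= j <oo) (rnorm (phi (x j)) `^ s)%:E) `^ s^-1)%E
            | phi in @dual_ball E].

Context (m : nat) (E : 'I_m -> normedModType K) (F : normedModType K).
Implicit Type T : (forall i, E i) -> F.

Definition multilinear T : Prop :=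
  forall (x : forall i, E i) (i : 'I_m),
    linear (fun u : E i => T (dfwith x i u)).

(* joint continuity, for the product topology on the domain *)
Definition multicontinuous T : Prop := continuous (T : prod_topology E -> F).

Definition absolutely_summing (r s : R) T : Prop :=
  exists C : R, 0 < C /\
    forall x : forall i, nat -> E i,
      (forall i, (weak_norm s (x i) < +oo)%E) ->
      ((\sum_(0 <= j <oo) (rnorm (T (fun i => x i j)) `^ r)%:E) `^ r^-1 <=
       (C * \prod_(i < m) fine (weak_norm s (x i)))%:E)%E.

End summing.

Definition summing_exponent (R : realType) (m : nat) (p : \bar R) : R :=
  match p with
  | p%:E => 2 * p / (m%:R * p + 2)
  | +oo%E => 2 / m%:R
  | -oo%E => 0
  end.

Lemma ge1_of_ge2 (R : realType) (p : \bar R) : (2%:E <= p)%E -> (1 <= p)%E.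
Proof. by apply: le_trans; rewrite lee_fin ler1n. Qed.

(* Main.v *)
Require Import Defs.
From HB Require Import structures.
From mathcomp Require Import all_boot all_order all_algebra.
From mathcomp Require Import complex ring lra.
From mathcomp Require Import all_classical all_reals all_analysis.

Set Implicit Arguments.
Unset Strict Implicit.
Unset Printing Implicit Defensive.

Import Order.TTheory GRing.Theory Num.Theory.
Import numFieldNormedType.Exports.

Local Open Scope classical_set_scope.
Local Open Scope ring_scope.

(** Write s(i) for the integer part of log_2 i, and let w_s be the Walsh matrix
    of order 2^s: its entries are signs, and it is 2^(s/2) times a unitary
    matrix. Cut the coordinates of l_p into the dyadic blocks of the indices
    2^s + j with j < 2^s, and put

      T(x^1, ..., x^m)_(2^s + j)
        = c_(2^s + j) prod_l sum_(t < 2^s) w_s(j, t) x^l_t,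

    where c_i = 2^(- g s(i)) and 1/p < g < 1/r - m/2. Such a g exists exactly
    because r < 2p / (mp + 2). The product is at most prod_l |x^l|_1 in every
    coordinate, and c lies in l_p because g > 1/p, so T is bounded, hence
    continuous ([walsh_product_diff], [walsh_product_continuous]). Here the
    strict inequality between r and the critical exponent is spent: it leaves
    room for a weight in l_p, so that the crude coordinatewise bound is enough
    and one operator carries all the blocks at once.

    Fix s, let n = 2^s, and take for each of the m sequences the n rows
    y_j = sum_(t < n) w_s(j, t) e_t of the Walsh matrix. For phi in the dual
    ball, the numbers phi(y_j) are the Walsh transform of a sequence bounded
    by 1, so by Parseval sum_j |phi(y_j)|^2 <= n^2 and therefore
    sum_j |phi(y_j)| <= n^(3/2) ([walsh_vector_weak_norm]). On the other side
    the coordinate 2^s + j of T(y_j, ..., y_j) is n^(- g) n^m, because the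
    squares of the n signs in a row add up to n. Summability would give
    n^(1/r + m - g) <= C n^(3m/2), that is n^(1/r - m/2 - g) <= C for every
    power n of 2 ([walsh_product_not_summing]), and the exponent is positive.

    The Walsh matrix is real, which treats both scalar fields together. *)

(** * Walsh matrices *)

Section Walsh.
Context (R : realType) (k : scalar_kind).
Local Notation K := (scalars R k).
Implicit Types (s i j : nat) (f : nat -> K^o).

(** Parity of the number of positions, among the [s] lowest ones, at which the
    binary expansions of [i] and [j] both have the digit 1. *)
Fixpoint dot_parity s i j : bool :=
  if s is s'.+1 then (odd i && odd j) (+) dot_parity s' i./2 j./2 else false.

Definition walsh s i j : K := (-1) ^+ dot_parity s i j.

Lemma walsh_sqr s i j : walsh s i j * walsh s i j = 1.
Proof. by rewrite -expr2 sqrr_sign. Qed.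

Lemma norm_walsh s i j : `|walsh s i j| = 1.
Proof. exact: normr_sign. Qed.

Definition walsh_transform s f i : K^o :=
  \sum_(j < 2 ^ s) walsh s i j * f j.

Lemma parallelogram (a b : K^o) :
  rnorm (a + b) ^+ 2 + rnorm (a - b) ^+ 2 = 2 * (rnorm a ^+ 2 + rnorm b ^+ 2).
Proof.
rewrite /rnorm; case: k a b => [a b|[a1 a2] [b1 b2]] /=.
  by rewrite !real_normK ?num_real//; ring.
by rewrite !sqr_sqrtr ?addr_ge0 ?sqr_ge0//; ring.
Qed.

Lemma sum_even_odd (V : nmodType) n (F : nat -> V) :
  \sum_(j < n.*2) F j = \sum_(j < n) (F j.*2 + F j.*2.+1).
Proof.
elim: n => [|n IH]; first by rewrite !big_ord0.
by rewrite doubleS !big_ord_recr /= IH addrA.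
Qed.

Lemma expn2S s : (2 ^ s.+1 = (2 ^ s).*2)%N.
Proof. by rewrite expnS mul2n. Qed.

Lemma walsh_transform_even s f i :
  walsh_transform s.+1 f i.*2 =
  walsh_transform s (fun j => f j.*2 + f j.*2.+1) i.
Proof.
rewrite /walsh_transform expn2S (sum_even_odd _
  (fun j => walsh s.+1 i.*2 j * f j)).
apply: eq_bigr => j _.
by rewrite /walsh /= !odd_double /= uphalf_double !doubleK mulrDr.
Qed.

Lemma walsh_transform_odd s f i :
  walsh_transform s.+1 f i.*2.+1 =
  walsh_transform s (fun j => f j.*2 - f j.*2.+1) i.
Proof.
rewrite /walsh_transform expn2S (sum_even_odd _
  (fun j => walsh s.+1 i.*2.+1 j * f j)).
apply: eq_bigr => j _.
rewrite /walsh /= !odd_double /= !uphalf_double !doubleK signrN.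
by rewrite mulNr mulrDr mulrN.
Qed.

(** Splitting the indices by parity turns the transform of order 2^(s+1) into
    two transforms of order 2^s, one of the sums and one of the differences of
    neighbours; the parallelogram identity recombines their norms. This avoids
    scalar products, so that real and complex scalars need no distinction. *)
Lemma walsh_parseval s f :
  \sum_(i < 2 ^ s) rnorm (walsh_transform s f i) ^+ 2 =
  (2 ^ s)%:R * \sum_(i < 2 ^ s) rnorm (f i) ^+ 2.
Proof.
elim: s f => [|s IH] f.
  by rewrite expn0 !big_ord1 /walsh_transform big_ord1 /walsh /= !mul1r.
rewrite expn2S.
rewrite (sum_even_odd _ (fun j => rnorm (walsh_transform s.+1 f j) ^+ 2)).
rewrite (sum_even_odd _ (fun j => rnorm (f j) ^+ 2)) -muln2 natrM -mulrA.
under eq_bigr do rewrite walsh_transform_even walsh_transform_odd.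
rewrite big_split /= !IH -mulrDr -big_split /=; congr (_ * _).
by rewrite mulr_sumr; apply: eq_bigr => j _; exact: parallelogram.
Qed.

(** Parseval bounds the sum of the squares by n^2 with n = 2^s, so that the
    Cauchy-Schwarz inequality gives n^(3/2) for the sum over n terms. *)
Lemma walsh_transform_l1 s f : (forall j, rnorm (f j) <= 1) ->
  \sum_(i < 2 ^ s) rnorm (walsh_transform s f i) <= 2 `^ (3 / 2 * s%:R).
Proof.
move=> f1; set t : R := 2 `^ (s%:R / 2).
have t0 : 0 < t by rewrite powR_gt0.
have t2 : t ^+ 2 = (2 ^ s)%:R.
  by rewrite -powR_mulrn ?powR_ge0// -powRrM divfK// powR_mulrn// natrX.
have -> : 2 `^ (3 / 2 * s%:R) = t ^+ 3 :> R.
  rewrite -powR_mulrn ?powR_ge0// -powRrM; congr (_ `^ _); by field.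
(* The Cauchy-Schwarz step, as the AM-GM inequality with t = sqrt n, which is
   the common size of the terms in the extremal case. *)
have amgm (a : R) : a <= (a ^+ 2 / t + t) / 2.
  have : 0 <= (a - t) ^+ 2 / t by rewrite divr_ge0 ?sqr_ge0 ?ltW.
  suff -> : (a ^+ 2 / t + t) / 2 = (a - t) ^+ 2 / t / 2 + a by lra.
  by field; rewrite gt_eqF.
apply: (@le_trans _ _
    (\sum_(i < 2 ^ s) (rnorm (walsh_transform s f i) ^+ 2 / t + t) / 2)).
  by apply: ler_sum => i _; exact: amgm.
have le1 : \sum_(i < 2 ^ s) rnorm (f i) ^+ 2 <= t ^+ 2.
  rewrite t2; apply: (@le_trans _ _ (\sum_(i < 2 ^ s) 1)).
    by apply: ler_sum => i _; rewrite exprn_ile1 ?rnorm_ge0.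
  by rewrite sumr_const card_ord.
rewrite -mulr_suml big_split /= -mulr_suml walsh_parseval sumr_const card_ord.
rewrite -[t *+ _]mulr_natr -t2; set S := \sum_(i < _) _ in le1 *.
have : t * S <= t * t ^+ 2 by rewrite ler_pM2l.
suff -> : t ^+ 2 * S / t = t * S by rewrite -!exprS; lra.
by field; rewrite gt_eqF.
Qed.

End Walsh.

(** Telescoping: replace the factors one at a time, each step costing one
    difference and at most [M] for every other factor. *)
Lemma prod_diff_le (F : numDomainType) (I : Type) (r : seq I) (a b : I -> F)
    (M : F) : 1 <= M ->
  (forall i, `|a i| <= M) -> (forall i, `|b i| <= M) ->
  `|\prod_(i <- r) a i - \prod_(i <- r) b i| <=
  M ^+ size r * \sum_(i <- r) `|a i - b i|.
Proof.
move=> M1 aM bM; have M0 : 0 <= M by apply: le_trans M1.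
have prodM (s : seq I) : `|\prod_(i <- s) a i| <= M ^+ size s.
  elim: s => [|i s IH]; first by rewrite big_nil normr1.
  by rewrite big_cons normrM exprS; apply: ler_pM.
elim: r => [|i r IH]; first by rewrite !big_nil subrr normr0 mulr0.
rewrite !big_cons /=.
have -> : a i * \prod_(j <- r) a j - b i * \prod_(j <- r) b j =
   (a i - b i) * \prod_(j <- r) a j
   + b i * (\prod_(j <- r) a j - \prod_(j <- r) b j) by ring.
apply: le_trans (ler_normD _ _) _; rewrite !normrM mulrDr; apply: lerD.
  rewrite mulrC ler_wpM2r// (le_trans (prodM _))//.
  by rewrite exprS ler_peMl// exprn_ge0.
by rewrite exprS -mulrA; apply: ler_pM.
Qed.

(** * Norm estimates in sequence spaces *)

Lemma nneseries_le_bound (R : realType) (f : nat -> R) (B : R) :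
  (forall i, 0 <= f i) -> (forall n, \sum_(i < n) f i <= B) ->
  (\sum_(0 <= i <oo) (f i)%:E <= B%:E)%E.
Proof.
move=> f0 fB; apply: lime_le.
  by apply: is_cvg_nneseries => i _ _; rewrite lee_fin.
by apply: nearW => n; rewrite sumEFin lee_fin big_mkord.
Qed.

Section lp_lemmas.
Context (R : realType) (k : scalar_kind).
Local Notation K := (scalars R k).

Lemma rnormN (V : normedModType K) (x : V) : rnorm (- x) = rnorm x.
Proof. by rewrite /rnorm normrN. Qed.

Lemma rnorm_of_real (a : R) : 0 <= a -> rnorm (of_real k a : K^o) = a.
Proof.
move=> a0; rewrite /rnorm ger0_norm ?of_realK//.
by rewrite -(of_real0 R k) of_real_le.
Qed.

Lemma rnormM (a b : K) :
  rnorm (a * b : K^o) = rnorm (a : K^o) * rnorm (b : K^o).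
Proof. exact: rnormZ. Qed.

Lemma rnorm_le_sum (I : Type) (r : seq I) (P : pred I) (F : I -> K^o) :
  rnorm (\sum_(i <- r | P i) F i) <= \sum_(i <- r | P i) rnorm (F i).
Proof.
elim/big_ind2 : _ => [|x x' y y' xy x'y'|//]; first by rewrite rnorm0.
by apply: le_trans (ler_rnormD _ _) _; exact: lerD.
Qed.

Lemma rnorm_prod (I : Type) (r : seq I) (F : I -> K) :
  rnorm (\prod_(i <- r) F i : K^o) = \prod_(i <- r) rnorm (F i : K^o).
Proof.
elim/big_ind2 : _ => [|x x' y y' <- <-|//]; last exact: rnormM.
by rewrite /rnorm normr1; case: k.
Qed.

Lemma lp_dominated (p : \bar R) (p1 : (1 <= p)%E) (c : lp_space k p1)
    (z : nat -> K^o) (M : R) : 0 <= M ->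
  (forall i, rnorm (z i) <= M * rnorm (c i)) ->
  (lp_norm p z <= (M * rnorm c)%:E)%E.
Proof.
move=> M0 zc; rewrite rnorm_lp EFinM lp_fine -(rnorm_of_real M0) -lp_normZ//.
apply: le_lp_norm => // i; rewrite rnorm_ge0 rnormZ rnorm_of_real//.
exact: zc.
Qed.

Lemma l1_sum_le (u : lp_space k (lexx (1 : \bar R)%E)) n :
  \sum_(j < n) rnorm (u j) <= rnorm u.
Proof.
rewrite -lee_fin rnorm_lp lp_fine lp_norm_fin// invr1.
rewrite poweRe1; last first.
  by apply: nneseries_ge0 => *; rewrite lee_fin powR_ge0.
apply: le_trans (nneseries_lim_ge n _); last first.
  by move=> *; rewrite lee_fin powR_ge0.
rewrite sumEFin lee_fin big_mkord; apply: ler_sum => i _.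
by rewrite powRr1 ?rnorm_ge0.
Qed.

End lp_lemmas.

(** * A weight in l_p that is constant on dyadic blocks *)

Section dyadic_weight.
Context (R : realType) (k : scalar_kind).
Local Notation K := (scalars R k).

Definition dyadic_weight (g : R) (i : nat) : R :=
  2 `^ (- (g * (trunc_log 2 i)%:R)).

Lemma dyadic_weight_block g s j : (j < 2 ^ s)%N ->
  dyadic_weight g (2 ^ s + j) = 2 `^ (- (g * s%:R)).
Proof.
move=> js; rewrite /dyadic_weight (trunc_log_eq (n := s))//.
by rewrite leq_addr expnS mul2n -addnn ltn_add2l.
Qed.

(** Cauchy condensation: the block of the indices between 2^N and 2^(N+1) has
    2^N terms equal to 2^(-(1+d)N), hence contributes the geometric term x^N
    with x = 2^(-d). *)
Lemma sum_dyadic_weight (d : R) : 0 < d ->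
  exists B : R, forall n, \sum_(i < n) dyadic_weight (1 + d) i <= B.
Proof.
move=> d0; set x : R := 2 `^ (- d).
have x0 : 0 < x by rewrite powR_gt0.
have x1 : x < 1.
  rewrite /x powRN invf_lt1 ?powR_gt0//.
  have : (1 : R) `^ d < 2 `^ d by rewrite gt0_ltr_powR ?nnegrE ?ltr1n.
  by rewrite powR1.
exists (1 + (1 - x)^-1) => n.
have block N : \sum_(i < 2 ^ N) dyadic_weight (1 + d) i <=
    1 + (1 - x ^+ N) / (1 - x).
  elim: N => [|N IH].
    rewrite expn0 big_ord1 expr0 subrr mul0r addr0.
    by rewrite /dyadic_weight trunc_log0 mulr0 oppr0 powRr0.
  rewrite expn2S -addnn big_split_ord /=.
  under [X in _ + X]eq_bigr do rewrite dyadic_weight_block//.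
  rewrite sumr_const card_ord.
  have -> : 2 `^ (- ((1 + d) * N%:R)) *+ 2 ^ N = x ^+ N :> R.
    rewrite mulrDl mul1r opprD powRD; last by apply/implyP; rewrite pnatr_eq0.
    rewrite -mulNr [X in _ * X]powRrM powR_mulrn ?powR_ge0// -mulrnAl.
    by rewrite powRN powR_mulrn// -mulr_natr natrX mulVf ?mul1r.
  have -> : 1 + (1 - x ^+ N.+1) / (1 - x) = 1 + (1 - x ^+ N) / (1 - x) + x ^+ N.
    by rewrite exprS; field; rewrite gt_eqF// subr_gt0.
  by rewrite lerD2r.
apply: (@le_trans _ _ (\sum_(i < 2 ^ n) dyadic_weight (1 + d) i)).
  rewrite -!(big_mkord xpredT) (big_cat_nat (leq0n n) (ltnW (ltn_expl n _)))//=.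
  by rewrite lerDl sumr_ge0// => *; exact: powR_ge0.
apply: le_trans (block n) _; rewrite lerD2l ler_pdivrMr ?subr_gt0//.
by rewrite mulVf ?gt_eqF ?subr_gt0// gerBl exprn_ge0// ltW.
Qed.

(** The number 1/p, which is 0 for p infinite. *)
Definition inv_exponent (p : \bar R) : R := if p is q%:E then q^-1 else 0.

Lemma dyadic_weight_mem (p : \bar R) (g : R) : (1 <= p)%E ->
  inv_exponent p < g ->
  (lp_norm p (fun i => of_real k (dyadic_weight g i) : K^o) < +oo)%E.
Proof.
case: p => [q q1 gq|_ /= g0|//].
  have q0 : 0 < q by move: q1; rewrite lee_fin; exact: lt_le_trans.
  have d0 : 0 < g * q - 1 by rewrite subr_gt0 -ltr_pdivrMr// mul1r.
  have [B leB] := sum_dyadic_weight d0.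
  rewrite lp_norm_fin//; apply: poweR_lty; apply: le_lt_trans (ltry B).
  apply: nneseries_le_bound => [i|n]; first exact: powR_ge0.
  apply: le_trans (leB n); apply: ler_sum => i _.
  rewrite rnorm_of_real ?powR_ge0// /dyadic_weight -powRrM addrC subrK.
  by rewrite mulNr mulrAC.
rewrite lp_norm_infty; apply: le_lt_trans (ltry 1).
apply: ge_ereal_sup => _ [j _ <-]; rewrite lee_fin.
rewrite rnorm_of_real ?powR_ge0// -(powRr0 (2 : R)) ler_powR ?ler1n//.
by rewrite oppr_le0 mulr_ge0// ltW.
Qed.

End dyadic_weight.

(** * The multilinear operator *)

Section walsh_product.
Context (R : realType) (k : scalar_kind).
Local Notation K := (scalars R k).
Local Notation l1 := (lp_space k (lexx (1 : \bar R)%E)).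

Lemma of_real_lt (a b : R) : (of_real k a < of_real k b) = (a < b).
Proof. by case: k => //=; exact: ltcR. Qed.

(** Row [j] of the Walsh matrix of order [2 ^ s], for [i = 2 ^ s + j] with
    [j < 2 ^ s]. The index 0 lies in no block; it gets [s = 0] and [j = 0]
    because [trunc_log 2 0 = 0] and the subtraction is truncated. *)
Definition walsh_row (i : nat) (u : nat -> K^o) : K :=
  walsh_transform (trunc_log 2 i) u (i - 2 ^ trunc_log 2 i).

Lemma walsh_row_linear i (a : K) (u v : l1) :
  walsh_row i (a *: u + v) = a * walsh_row i u + walsh_row i v.
Proof.
rewrite /walsh_row /walsh_transform mulr_sumr -big_split /=.
by apply: eq_bigr => j _; rewrite mulrCA -mulrDr.
Qed.

Lemma walsh_rowB i (u v : l1) :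
  walsh_row i u - walsh_row i v = walsh_row i (u - v).
Proof. by rewrite addrC -mulN1r -walsh_row_linear scaleN1r addrC. Qed.

Lemma walsh_row_le i (u : l1) : rnorm (walsh_row i u : K^o) <= rnorm u.
Proof.
apply: le_trans (rnorm_le_sum _ _ _) _.
apply: le_trans (l1_sum_le _ (2 ^ trunc_log 2 i)); apply: ler_sum => j _.
by rewrite rnormM {1}/rnorm norm_walsh (_ : realpart 1 = 1) ?mul1r//; case: k.
Qed.

Lemma walsh_row_block s j (u : nat -> K^o) : (j < 2 ^ s)%N ->
  walsh_row (2 ^ s + j) u = walsh_transform s u j.
Proof.
move=> js; rewrite /walsh_row (trunc_log_eq (n := s)) ?addKn//.
by rewrite leq_addr expn2S -addnn ltn_add2l.
Qed.

Context (p : \bar R) (p1 : (1 <= p)%E) (c : lp_space k p1) (m : nat).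
Implicit Types x y : 'I_m -> l1.

Definition walsh_product_seq x (i : nat) : K^o :=
  c i * \prod_(l < m) walsh_row i (x l).

Lemma walsh_product_mem x : walsh_product_seq x \in @lp_mem R k p.
Proof.
rewrite inE /=; apply: le_lt_trans (ltry (\prod_(l < m) rnorm (x l) * rnorm c)).
apply: lp_dominated => [|i]; first by apply: prodr_ge0 => l _; exact: rnorm_ge0.
rewrite rnormM mulrC ler_wpM2r ?rnorm_ge0// rnorm_prod.
by apply: ler_prod => l _; rewrite rnorm_ge0 walsh_row_le.
Qed.

Definition walsh_product x : lp_space k p1 := Lp p1 (walsh_product_mem x).

Lemma walsh_product_multilinear : multilinear walsh_product.
Proof.
move=> x l a u v; apply: val_inj; apply: funext => i /=.
rewrite /walsh_product_seq (bigD1 l)//=.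
have E (w : l1) : c i * \prod_(j < m) walsh_row i (dfwith x l w j) =
    c i * (walsh_row i w * \prod_(j < m | j != l) walsh_row i (x j)).
  rewrite (bigD1 l)//= dfwithin; congr (_ * (_ * _)).
  by apply: eq_bigr => j jl; rewrite dfwithout// eq_sym.
transitivity (a * (walsh_product_seq (dfwith x l u) i) +
   walsh_product_seq (dfwith x l v) i); last by [].
rewrite -(bigD1 (P := xpredT) l)//= /walsh_product_seq !E walsh_row_linear; ring.
Qed.

(** The estimate holds coordinatewise up to the factor [c i], because a row of
    the Walsh matrix is a functional of norm at most 1 on l_1; that [c] is in
    l_p then gives it in norm. *)
Lemma walsh_product_diff x y (B : R) : 1 <= B ->
  (forall l, rnorm (x l) <= B) -> (forall l, rnorm (y l) <= B) ->
  rnorm (walsh_product x - walsh_product y) <=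
  B ^+ m * (\sum_(l < m) rnorm (x l - y l)) * rnorm c.
Proof.
move=> B1 xB yB; rewrite -lee_fin {1}rnorm_lp lp_fine.
have B0 : 0 <= B by apply: le_trans B1.
apply: lp_dominated => [|i].
  by rewrite mulr_ge0 ?exprn_ge0// sumr_ge0// => l _; exact: rnorm_ge0.
have -> : (walsh_product x - walsh_product y : lp_space k p1) i =
  c i * (\prod_(l < m) walsh_row i (x l) - \prod_(l < m) walsh_row i (y l)).
  by rewrite mulrBr.
rewrite rnormM mulrC ler_wpM2r ?rnorm_ge0//.
rewrite -(of_real_le k) of_rnorm.
have rowB (u : l1) : rnorm u <= B -> `|walsh_row i u| <= of_real k B.
  move=> uB; rewrite -(of_rnorm (walsh_row i u : K^o)) of_real_le.
  by apply: le_trans uB; exact: walsh_row_le.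
have B1' : 1 <= of_real k B.
  have -> : 1 = of_real k 1 by case: k.
  by rewrite of_real_le.
apply: le_trans (prod_diff_le _ B1' (fun l => rowB _ (xB l))
  (fun l => rowB _ (yB l))) _.
have ofX (n : nat) : of_real k (B ^+ n) = of_real k B ^+ n.
  elim: n => [|n IH]; first by rewrite !expr0; case: k.
  by rewrite !exprS of_realM IH.
rewrite of_realM ofX -sum1_size sum1_card card_ord.
rewrite ler_wpM2l ?exprn_ge0 ?(le_trans ler01)//.
rewrite (big_morph (of_real k) (@of_realD R k) (of_real0 R k)).
apply: ler_sum => l _; rewrite walsh_rowB -(of_rnorm (walsh_row i _ : K^o)).
by rewrite of_real_le walsh_row_le.
Qed.

Lemma walsh_product_continuous : multicontinuous walsh_product.
Proof.
move=> x; apply: (@cvgrPdist_lt K (lp_space k p1) (prod_topology (fun=> l1))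
  (nbhs x) _ walsh_product (walsh_product x)).2 => e e0.
set e' := realpart e.
have ee' : e = of_real k e' by rewrite realpartK// ltW.
have {e0} e'0 : 0 < e' by rewrite -of_real_lt -ee' of_real0.
(* B bounds the norms of x and of every y whose components are within 1 of
   those of x; A is then the Lipschitz constant for the maximum of the
   distances between components. *)
set B := \sum_(l < m) rnorm (x l) + 1 + 1.
have S0 : 0 <= \sum_(l < m) rnorm (x l).
  by apply: sumr_ge0 => l _; exact: rnorm_ge0.
have B1 : 1 <= B by rewrite /B; lra.
have xB l : rnorm (x l) <= B - 1.
  rewrite /B addrK ler_wpDr// (bigD1 l)//= lerDl.
  by apply: sumr_ge0 => j _; exact: rnorm_ge0.
set A := B ^+ m * m%:R * rnorm c.
have A0 : 0 <= A.
  by rewrite !mulr_ge0 ?exprn_ge0 ?ler0n ?rnorm_ge0// (le_trans ler01).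
set d := Num.min 1 (e' / (A + 1)).
have d0 : 0 < d by rewrite lt_min ltr01 divr_gt0// ltr_wpDl.
have near_x : \forall y \near (x : prod_topology (fun=> l1)),
    forall l, rnorm (x l - y l) < d.
  apply: (@filter_forall _ _ _ _
    (nbhs_filter (x : prod_topology (fun=> l1)))) => l.
  have := (@cvgrPdist_lt K l1 (prod_topology (fun=> l1)) (nbhs x)
    (nbhs_filter (x : prod_topology (fun=> l1)))
    (@proj 'I_m (fun=> l1) l) (x l)).1 (@proj_continuous 'I_m (fun=> l1) l x)
    (of_real k d).
  rewrite -{1}(of_real0 R k) of_real_lt => /(_ d0).
  by apply: filterS => y; rewrite -of_rnorm of_real_lt.
apply: (@filterS _ _ (nbhs_filter (x : prod_topology (fun=> l1)))
  _ _ _ near_x) => y yd.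
rewrite ee' -of_rnorm of_real_lt.
have yB l : rnorm (y l) <= B.
  rewrite -[y l](subrK (x l)) (le_trans (ler_rnormD _ _))//.
  rewrite -rnormN opprB; have := xB l; have := yd l.
  rewrite lt_min => /andP[]; lra.
have xB' l : rnorm (x l) <= B by have := xB l; lra.
apply: le_lt_trans (walsh_product_diff B1 xB' yB) _.
apply: (@le_lt_trans _ _ (A * d)).
  rewrite /A [leRHS]mulrAC ler_wpM2r ?rnorm_ge0// -mulrA ler_wpM2l ?exprn_ge0//.
    by rewrite (le_trans ler01).
  rewrite mulr_natl -[m in X in _ <= X]card_ord -sumr_const.
  by apply: ler_sum => l _; exact: ltW.
apply: (@le_lt_trans _ _ (A * (e' / (A + 1)))).
  by rewrite ler_wpM2l// ge_min lexx orbT.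
rewrite mulrA ltr_pdivrMr ?ltr_wpDl// mulrC ltr_pM2l//; lra.
Qed.

End walsh_product.

(** * The test vectors *)

Section walsh_vectors.
Context (R : realType) (k : scalar_kind).
Local Notation K := (scalars R k).
Local Notation l1 := (lp_space k (lexx (1 : \bar R)%E)).

Lemma rnorm_nat n : rnorm (n%:R : K^o) = n%:R.
Proof.
rewrite -[RHS](rnorm_of_real k (ler0n R n)); congr (rnorm (_ : K^o)).
elim: n => [|n IH]; first by rewrite of_real0.
by rewrite -[in RHS]natr1 of_realD -IH -natr1; congr (_ + _); case: k.
Qed.

Definition unit_seq (j : nat) : nat -> K^o := fun i => (i == j)%:R.

Lemma unit_seq_norm j : (lp_norm 1 (unit_seq j) <= 1)%E.
Proof.
rewrite lp_norm_fin// invr1 poweRe1; last first.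
  by apply: nneseries_ge0 => *; rewrite lee_fin powR_ge0.
apply: nneseries_le_bound => [i|n]; first exact: powR_ge0.
apply: (@le_trans _ _ (j < n)%:R); last by rewrite lern1 leq_b1.
elim: n => [|n IH]; first by rewrite big_ord0 ler0n.
rewrite big_ord_recr /= powRr1 ?rnorm_ge0// /unit_seq; move: IH.
case: eqVneq => [<-|nj]; last first.
  rewrite rnorm0 addr0 ltnS [in X in _ -> X]leq_eqVlt.
  by rewrite [j == n]eq_sym (negPf nj).
have -> : rnorm (true%:R : K^o) = 1 by rewrite /rnorm normr1; case: k.
by rewrite ltnn ltnSn => S0; rewrite -[leRHS]add0r lerD2r.
Qed.

Lemma unit_seq_mem j : unit_seq j \in @lp_mem R k 1.
Proof. by rewrite inE; apply: le_lt_trans (unit_seq_norm j) (ltry 1). Qed.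

Definition l1_unit j : l1 := Lp (lexx (1 : \bar R)%E) (unit_seq_mem j).

Lemma l1_unit_norm j : rnorm (l1_unit j) <= 1.
Proof. by rewrite -lee_fin rnorm_lp lp_fine; exact: unit_seq_norm. Qed.

(** The rows of the Walsh matrix of order [2 ^ s], extended by 0 to an infinite
    sequence of vectors. *)
Definition walsh_vector (s j : nat) : l1 :=
  if (j < 2 ^ s)%N then \sum_(i < 2 ^ s) walsh R k s j i *: l1_unit i else 0.

Lemma walsh_vector_coord s j i : (j < 2 ^ s)%N -> (i < 2 ^ s)%N ->
  walsh_vector s j i = walsh R k s j i.
Proof.
move=> js i_s; rewrite /walsh_vector js.
rewrite (big_morph (fun u : l1 => u i) (id1 := 0) (op1 := +%R))//.
rewrite (bigD1 (Ordinal i_s))//= big1 => [|t ti]; last first.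
  have /negPf it : i != t by apply: contra ti => /eqP it; apply/eqP/val_inj.
  by rewrite -[LHS]/(walsh R k s j t * (i == t)%:R) it mulr0.
by rewrite addr0 -[LHS]/(walsh R k s j i * (i == i)%:R) eqxx mulr1.
Qed.

(** Row [j] is paired with itself, so every term is the square of a sign. *)
Lemma walsh_row_vector s j : (j < 2 ^ s)%N ->
  walsh_row (2 ^ s + j) (walsh_vector s j) = (2 ^ s)%:R.
Proof.
move=> js; rewrite walsh_row_block// /walsh_transform.
under eq_bigr do rewrite walsh_vector_coord// walsh_sqr.
by rewrite sumr_const card_ord.
Qed.

Lemma dual_ball_sum (phi : l1 -> K^o) n (a : nat -> K) (u : nat -> l1) :
  dual_ball phi ->
  phi (\sum_(i < n) a i *: u i) = \sum_(i < n) a i * phi (u i).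
Proof.
case=> lin_phi _ _; pose h := HB.pack_for {linear l1 -> K^o} phi
  (GRing.isLinear.Build _ _ _ _ phi lin_phi).
rewrite -[phi]/(h : l1 -> K^o) linear_sum.
by apply: eq_bigr => i _; rewrite linearZ.
Qed.

(** A functional of norm at most 1 maps the unit vectors to scalars of modulus
    at most 1, and the test vectors to the Walsh transform of these scalars. *)
Lemma walsh_vector_weak_norm s :
  (weak_norm 1 (walsh_vector s) <= (2 `^ (3 / 2 * s%:R))%:E)%E.
Proof.
apply: ge_ereal_sup => _ [phi phiB <-].
rewrite invr1 poweRe1; last first.
  by apply: nneseries_ge0 => *; rewrite lee_fin powR_ge0.
apply: nneseries_le_bound => [i|n]; first exact: powR_ge0.
have phi0 : phi 0 = 0 :> K^o.
  have := @dual_ball_sum phi 0 (fun=> 0) (fun=> 0) phiB.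
  by rewrite !big_ord0.
set f := fun j => phi (l1_unit j).
have f1 j : rnorm (f j) <= 1.
  by case: phiB => _ _; apply; exact: l1_unit_norm.
have phiE j : (j < 2 ^ s)%N -> phi (walsh_vector s j) = walsh_transform s f j.
  by move=> js; rewrite /walsh_vector js (dual_ball_sum _ (walsh R k s j)).
apply: le_trans (walsh_transform_l1 s f1).
rewrite (eq_bigr (fun j : 'I_n => rnorm (phi (walsh_vector s j)))); last first.
  by move=> j _; rewrite powRr1 ?rnorm_ge0.
apply: (@le_trans _ _ (\sum_(j < n + 2 ^ s) rnorm (phi (walsh_vector s j)))).
  by rewrite big_split_ord /= lerDl sumr_ge0// => j _; exact: rnorm_ge0.
rewrite addnC big_split_ord /= [X in _ + X]big1 ?addr0 => [|j _]; last first.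
  by rewrite /walsh_vector ltnNge leq_addr phi0 rnorm0.
by apply: ler_sum => j _; rewrite phiE.
Qed.

End walsh_vectors.

(** The zero functional shows that the supremum is over a nonempty set. *)
Lemma weak_norm_ge0 (R : realType) (k : scalar_kind)
    (E : normedModType (scalars R k)) (s : R) (x : nat -> E) :
  (0 <= weak_norm s x)%E.
Proof.
apply: le_trans (poweR_ge0 _ s^-1) _; apply: ereal_sup_ubound.
exists (fun=> 0); last by [].
split; first by move=> a u v; rewrite /= scaler0 addr0.
- exact: cst_continuous.
- by move=> u _; rewrite rnorm0 ler01.
Qed.

(** * Failure of summability *)

Lemma powR2_unbounded (R : realType) (C d : R) : 0 < d ->
  exists s : nat, C < 2 `^ (d * s%:R).
Proof.
move=> d0; have ln2 : 0 < ln (2 : R) by rewrite ln_gt0 ?ltr1n.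
have a0 : 0 < d * ln 2 by rewrite mulr_gt0.
exists (Num.truncn (C / (d * ln 2))).+1; set s := _.+1.
rewrite /powR pnatr_eq0 /=; apply: lt_le_trans (expR_ge1Dx _).
rewrite mulrAC -ltrBlDl (lt_trans (_ : _ < C)) ?gtrBl//.
by rewrite mulrC -ltr_pdivrMr// truncnS_gt.
Qed.

(** With n = 2^s, each of the n images has norm at least n^(m-g) while each of
    the m weak norms is at most n^(3/2), so a summability constant would bound
    n^(1/r + m - g) / n^(3m/2) = n^(1/r - m/2 - g) for all s. *)
Lemma walsh_product_not_summing (R : realType) (k : scalar_kind) (m : nat)
    (p : \bar R) (p1 : (1 <= p)%E) (c : lp_space k p1) (g r : R) : 0 < r ->
  (forall i, rnorm (c i) = dyadic_weight g i) ->
  m%:R / 2 + g < r^-1 ->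
  ~ absolutely_summing r 1 (@walsh_product R k p p1 c m).
Proof.
move=> r0 cg gr [C [C0 Csum]].
have d0 : 0 < r^-1 - (m%:R / 2 + g) by rewrite subr_gt0.
have [s] := powR2_unbounded C d0; rewrite ltNge => /negP; apply.
have wn := walsh_vector_weak_norm R k s.
set B : R := 2 `^ (3 / 2 * s%:R) in wn.
have wn0 : (0 <= weak_norm 1 (@walsh_vector R k s))%E := weak_norm_ge0 _ _.
have := Csum (fun=> @walsh_vector R k s) (fun=> le_lt_trans wn (ltry _)).
rewrite prodr_const card_ord.
set S := (\sum_(0 <= j <oo) _)%E => leS.
have {}leS : (S `^ r^-1 <= (C * B ^+ m)%:E)%E.
  apply: le_trans leS _; rewrite lee_fin ler_pM2l//.
  rewrite lerXn2r ?nnegrE ?fine_ge0 ?powR_ge0//.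
  by rewrite -lee_fin fineK// ge0_fin_numE// (le_lt_trans wn)// ltry.
(* a = n^(m - g): the weight n^(-g) times the m factors n. *)
set a : R := 2 `^ (s%:R * (m%:R - g)).
have leT j : (j < 2 ^ s)%N ->
    a <= rnorm (@walsh_product R k p p1 c m (fun=> walsh_vector R k s j)).
  move=> js; rewrite -lee_fin rnorm_lp lp_fine.
  apply: le_trans (lp_norm_coord p1 _ (2 ^ s + j)).
  rewrite lee_fin /= /walsh_product_seq prodr_const card_ord rnormM cg.
  rewrite dyadic_weight_block// walsh_row_vector//.
  have -> : rnorm ((2 ^ s)%:R ^+ m : (scalars R k)^o) = 2 `^ (s%:R * m%:R).
    by rewrite -natrX rnorm_nat natrX powRrM !powR_mulrn ?ler0n// natrX.
  rewrite -powRD; last by apply/implyP; rewrite pnatr_eq0.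
  by rewrite /a mulrBr addrC [s%:R * g]mulrC.
have leS2 : (((2 ^ s)%:R * a `^ r)%:E <= S)%E.
  apply: le_trans (nneseries_lim_ge (2 ^ s) _); last first.
    by move=> *; rewrite lee_fin powR_ge0.
  rewrite sumEFin lee_fin big_mkord mulr_natl -[X in _ *+ X]card_ord.
  rewrite -sumr_const.
  apply: ler_sum => j _; apply: ge0_ler_powR => //; first exact: ltW.
  - by rewrite nnegrE powR_ge0.
  - by rewrite nnegrE rnorm_ge0.
  exact: leT.
have : ((2 ^ s)%:R * a `^ r) `^ r^-1 <= C * B ^+ m.
  rewrite -lee_fin; apply: le_trans leS; rewrite -poweR_EFin.
  apply: gt0_ler_poweR => //; first by rewrite invr_ge0 ltW.
    by rewrite in_itv /= leey lee_fin mulr_ge0 ?powR_ge0.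
  rewrite in_itv /= leey andbT; apply: nneseries_ge0 => *.
  by rewrite lee_fin powR_ge0.
have -> : (2 ^ s)%:R = 2 `^ s%:R :> R by rewrite powR_mulrn// natrX.
rewrite /a /B -powR_mulrn ?powR_ge0// -!powRrM -powRD; last first.
  by apply/implyP; rewrite pnatr_eq0.
rewrite -powRrM -ler_pdivrMr ?powR_gt0// -powRB; last first.
  by apply/implyP; rewrite pnatr_eq0.
congr (_ `^ _ <= _); field; exact: lt0r_neq0.
Qed.


Theorem mainTheorem1 (R : realType) (k : scalar_kind) (m : nat)
    (m_gt0 : (0 < m)%N) (p : \bar R) (p_ge2 : (2%:E <= p)%E)
    (r : R) (r_gt0 : 0 < r) (r_lt : r < summing_exponent m p) :
  exists T : ('I_m -> lp_space k (lexx (1 : \bar R)%E)) ->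
             lp_space k (ge1_of_ge2 p_ge2),
    [/\ multilinear T, multicontinuous T & ~ absolutely_summing r 1 T].
Proof.
(* The hypothesis on r in terms of 1/r, uniformly in p. *)
have gap : m%:R / 2 + inv_exponent p < r^-1.
  have m0 : 0 < m%:R :> R by rewrite ltr0n.
  have := r_lt; case: p p_ge2 {r_lt} => [q q2|_|//] /= r_lt.
    have q0 : 0 < q by move: (q2); rewrite lee_fin; exact: lt_le_trans.
    have mq0 : 0 < m%:R * q + 2 by rewrite addr_gt0 ?mulr_gt0.
    rewrite -[ltLHS]invrK ltf_pV2 ?posrE//; last first.
      by rewrite invr_gt0 addr_gt0 ?divr_gt0 ?invr_gt0.
    suff -> : (m%:R / 2 + q^-1)^-1 = 2 * q / (m%:R * q + 2) by [].
    by field; rewrite !gt_eqF.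
  by rewrite addr0 -[ltLHS]invrK ltf_pV2 ?posrE ?invr_gt0 ?divr_gt0// invf_div.
set g := (inv_exponent p + (r^-1 - m%:R / 2)) / 2.
have pg : inv_exponent p < g by rewrite /g; lra.
have gr : m%:R / 2 + g < r^-1 by rewrite /g; lra.
have wmem : (fun i => of_real k (dyadic_weight g i) : (scalars R k)^o)
    \in @lp_mem R k p by rewrite inE; exact: dyadic_weight_mem (ge1_of_ge2 p_ge2) pg.
exists (@walsh_product R k p _ (Lp (ge1_of_ge2 p_ge2) wmem) m); split.
- exact: walsh_product_multilinear.
- exact: walsh_product_continuous.
- apply: (walsh_product_not_summing r_gt0 _ gr) => i.
  by rewrite rnorm_of_real ?powR_ge0.
Qed.
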